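(* Let $(\Omega,\mathcal{F},\mu)$ be a complete $\sigma$-finite measure space with $\mu(\Omega)>0$. Let $(X,Y,\langle\cdot,\cdot\rangle)$ be a dual pair of Banach spaces such that $|\langle x,y\rangle|\le\|x\|\,\|y\|$ for all $x\in X$, $y\in Y$, and such that $\{x\in X:\|x\|\le1\}$ is $\sigma(X,Y)$-closed and $\{y\in Y:\|y\|\le1\}$ is $\sigma(Y,X)$-closed. Let $f:X\to\overline{L^0}$ be proper convex. Then $f$ is lower semi-continuous if and only if $$f(x)=\operatorname*{ess\,sup}_{y\in L^0(Y)}\{\langle x,y\rangle-f^\ast(y)\}\quad\text{for all }x\in X,$$ where $f^\ast(y)=\operatorname*{ess\,sup}_{x\in X}\{\langle x,y\rangle-f(x)\}$ for all $y\in L^0(Y)$.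
   Context: $\overline{L^0}$ is the set of measurable functions $\Omega\to\mathbb{R}\cup\{\pm\infty\}$ modulo a.e. equality, ordered by a.e. dominance; $L^0$ is the subset of (classes of) real-valued functions and $L^0_{++}=\{r\in L^0:r>0\text{ a.e.}\}$. All equalities and inequalities (including strict ones) are understood almost everywhere. $\operatorname{ess\,sup}$ and $\operatorname{ess\,inf}$ denote supremum and infimum in the complete lattice $\overline{L^0}$. A dual pair $(X,Y,\langle\cdot,\cdot\rangle)$ is a pair of real vector spaces with a real bilinear form separating points on both sides; $\sigma(X,Y)$ is the weak topology on $X$ induced by $Y$. $L^0(X)$ is the space of strongly measurable functions $\Omega\to X$ (a.e. norm-limits of simple functions) modulo a.e. equality; similarly $L^0(Y)$. For $x\in L^0(X)$, $y\in L^0(Y)$, $\langle x,y\rangle\in L^0$ is given by $\langle x,y\rangle(\omega)=\langle x(\omega),y(\omega)\rangle$ a.e.; $X$ is identified with the constant functions in $L^0(X)$. Let $X_s=\{\sum_n x_n1_{A_n}:(x_n)\text{ a sequence in }X,\ (A_n)\text{ a countable measurable partition of }\Omega\}\subseteq L^0(X)$. For $f:X\to\overline{L^0}$ let $f_s:X_s\to\overline{L^0}$, $f_s(\sum_n x_n1_{A_n})=\sum_n f(x_n)1_{A_n}$, i.e. $f_s(\sum_n x_n1_{A_n})=f(x_n)$ a.e. on $A_n$ for each $n$. For $x\in X$, let $\mathcal{V}(x)$ be the collection of all sets $$V=\{z\in L^0(X): |\langle z-x,y_l\rangle|\le r\text{ a.e. on }\{N\ge l\}\text{ for every }l\in\{1,2,\dots\}\},$$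 where $r\in L^0_{++}$, $N:\Omega\to\{1,2,\dots\}$ is measurable, and $(y_l)_{l\ge1}$ is a sequence in $L^0(Y)$ (this is a neighbourhood given by a ''conditionally finite'' family of $N$ elements of $L^0(Y)$). The function $f$ is lower semi-continuous if $$f(x)=\operatorname*{ess\,sup}_{V\in\mathcal{V}(x)}\operatorname{ess\,inf}\{f_s(z):z\in V\cap X_s\}\quad\text{for all }x\in X.$$ $f$ is proper convex if $-\infty<f(x)$ a.e. for all $x\in X$, $f(x_0)\in L^0$ for at least one $x_0\in X$, and $f(\lambda x+(1-\lambda)y)\le\lambda f(x)+(1-\lambda)f(y)$ for all $x,y\in X$ and $\lambda\in\mathbb{R}$ with $0\le\lambda\le1$ (convention $0\cdot\infty=0$). *)

(* Defs.v *)
From HB Require Import structures.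
From mathcomp Require Import all_boot all_order all_algebra sesquilinear.
From mathcomp Require Import all_classical all_reals all_analysis measurable_realfun.
Import Order.TTheory GRing.Theory Num.Theory.
Import numFieldNormedType.Exports.

Set Implicit Arguments.
Unset Strict Implicit.
Unset Printing Implicit Defensive.

Local Open Scope classical_set_scope.
Local Open Scope ring_scope.

(* Classes of functions modulo a.e. equality are handled through their
   representatives: a set of classes is an a.e.-invariant set of functions, and
   every (in)equality between classes is an a.e. (in)equality. *)

Section lattice_L0.
Context d (T : measurableType d) (R : realType).
Variable mu : {measure set T -> \bar R}.
Local Open Scope ereal_scope.

Definition ae_le (g h : T -> \bar R) := {ae mu, forall w, g w <= h w}.

Definition is_esssup (S : set (T -> \bar R)) (g : T -> \bar R) :=
  [/\ measurable_fun setT g,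
      forall h, S h -> ae_le h g &
      forall g', measurable_fun setT g' ->
        (forall h, S h -> ae_le h g') -> ae_le g g'].

Definition is_essinf (S : set (T -> \bar R)) (g : T -> \bar R) :=
  [/\ measurable_fun setT g,
      forall h, S h -> ae_le g h &
      forall g', measurable_fun setT g' ->
        (forall h, S h -> ae_le g' h) -> ae_le g' g].

(* When mu is sigma-finite the lattice is complete, so the default value of
   xget is never reached; the result is unique up to a.e. equality. *)
Definition esssup (S : set (T -> \bar R)) : T -> \bar R :=
  xget (cst -oo) (is_esssup S).

Definition essinf (S : set (T -> \bar R)) : T -> \bar R :=
  xget (cst +oo) (is_essinf S).

End lattice_L0.

Section vector_valued_L0.
Context d (T : measurableType d) (R : realType).
Variables (mu : {measure set T -> \bar R}) (X : normedModType R).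

Definition simple_fun (s : T -> X) :=
  finite_set (range s) /\ forall x, measurable (s @^-1` [set x]).

Definition L0 : set (T -> X) :=
  [set z | exists s : nat -> T -> X, (forall n, simple_fun (s n)) /\
    {ae mu, forall w, s n w @[n --> \oo] --> z w}].

(* the pieces of a partition may be empty, so finite partitions are included *)
Definition countable_partition (A : nat -> set T) :=
  [/\ forall n, measurable (A n), trivIset setT A & \bigcup_n A n = setT].

Definition is_step (xs : nat -> X) (A : nat -> set T) (z : T -> X) :=
  forall n, {ae mu, forall w, A n w -> z w = xs n}.

Definition Xs : set (T -> X) :=
  [set z | exists xs A, countable_partition A /\ is_step xs A z].

(* evaluating f at the value z w gives f_s z = f (xs n) a.e. on A n, without
   choosing a representation of z: see step_extE *)
Definition step_ext (f : X -> T -> \bar R) (z : T -> X) : T -> \bar R :=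
  fun w => f (z w) w.

Lemma step_extE f xs A z : is_step xs A z ->
  forall n, {ae mu, forall w, A n w -> step_ext f z w = f (xs n) w}.
Proof.
move=> zA n; apply: filterS (zA n) => w zw Aw.
by rewrite /step_ext zw.
Qed.

Definition proper_convex (f : X -> T -> \bar R) :=
  [/\ forall x, {ae mu, forall w, (-oo < f x w)%E},
      exists x0, {ae mu, forall w, f x0 w \is a fin_num} &
      forall (x y : X) (k : R), 0 <= k <= 1 ->
        {ae mu, forall w, (f (k *: x + (1 - k) *: y)%R w
                            <= k%:E * f x w + (1 - k)%:E * f y w)%E}].

End vector_valued_L0.

Arguments L0 {d T R} mu X.
Arguments Xs {d T R} mu X.

Section duality.
Context (R : realType) (X Y : normedModType R) (b : X -> Y -> R).

Definition separating :=
  (forall x, (forall y, b x y = 0) -> x = 0) /\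
  (forall y, (forall x, b x y = 0) -> y = 0).

(* sigma(X, Y): initial topology for x |-> <x, .>, pointwise convergence on Y *)
Definition weak_space : topologicalType :=
  initial_topology (b : X -> {ptws Y -> R^o}).

Definition weakly_closed (C : set X) := closed (C : set weak_space).

Context d (T : measurableType d) (mu : {measure set T -> \bar R}).

Definition cond_ball (x : X) (r : T -> R) (N : T -> nat) (y : nat -> T -> Y) :
    set (T -> X) :=
  [set z | L0 mu X z /\ forall l, (1 <= l)%N ->
    {ae mu, forall w, (l <= N w)%N -> `|b (z w - x) (y l w)| <= r w}].

Definition cond_nbhs (x : X) : set (set (T -> X)) :=
  [set V | exists (r : T -> R) (N : T -> nat) (y : nat -> T -> Y),
    [/\ measurable_fun setT r /\ {ae mu, forall w, 0 < r w},
        measurable_fun setT N /\ (forall w, (1 <= N w)%N),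
        forall l, (1 <= l)%N -> L0 mu Y (y l) &
        V = cond_ball x r N y]].

Definition cond_lsc (f : X -> T -> \bar R) := forall x,
  f x = esssup mu [set essinf mu (step_ext f @` (V `&` Xs mu X))
                    | V in cond_nbhs x] %[ae mu].

Definition conjugate (f : X -> T -> \bar R) (y : T -> Y) : T -> \bar R :=
  esssup mu [set (fun w => (b x (y w))%:E - f x w)%E | x in [set: X]].

End duality.

(* Main.v *)
Require Import Defs.
From HB Require Import structures.
From mathcomp Require Import all_boot all_order all_algebra sesquilinear.
From mathcomp Require Import all_classical all_reals all_analysis measurable_realfun.
From mathcomp Require Import ring lra.
Import Order.TTheory GRing.Theory Num.Theory.
Import numFieldNormedType.Exports HBSimple.
Set Implicit Arguments.
Unset Strict Implicit.
Unset Printing Implicit Defensive.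
Local Open Scope classical_set_scope.
Local Open Scope ring_scope.

(* A neighbourhood V of x given by y_1, ..., y_N becomes, on {N = n}, a condition
   on the finitely many numbers <z - x, y_l>, so the nontrivial direction only
   needs finite-dimensional duality.  Write m for the essential infimum of f_s
   over V and m' for the one over a neighbourhood of a point x0 where f is
   finite.  Convexity at x0 turns f >= m' near x0 into a bound of f from below by
   a multiple of a seminorm; together with f >= m near x this gives
   f(z) >= m - sum_l |<z - x, v_l>| for all z, with finitely many v_l in L^0(Y).
   A conditional one-dimensional Hahn-Banach argument, repeated for each l,
   replaces -|<z - x, v_l>| by a_l <z - x, v_l> with a_l in L^0; then
   y = sum_l a_l v_l satisfies <x, y> - f*(y) >= m. *)

(** * Essential suprema *)

Lemma ae_forall_countType d (T : measurableType d) (R : realType)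
    (mu : {measure set T -> \bar R}) (I : countType) (P : I -> T -> Prop) :
  (forall i, {ae mu, forall w, P i w}) -> {ae mu, forall w, forall i, P i w}.
Proof.
move=> aeP.
have /ae_foralln : forall n, {ae mu, forall w,
    if unpickle n is Some i then P i w else True}.
  by move=> n; case: (unpickle n) => [i|]; [exact: aeP|exact: aeW].
by apply: filterS => w Pw i; have := Pw (pickle i); rewrite pickleK.
Qed.

Lemma lte_rat_between (R : realType) (x y : \bar R) : (x < y)%E ->
  exists q : rat, (x <= (ratr q)%:E < y)%E.
Proof.
case: x y => [x| |] [y| |] //=.
- rewrite lte_fin => /rat_in_itvoo[q]; rewrite in_itv /= => /andP[xq qy].
  by exists q; rewrite lee_fin lte_fin (ltW xq).
- move=> _; have /rat_in_itvoo[q] : x < x + 1 by rewrite ltrDl.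
  by rewrite in_itv /= => /andP[xq _]; exists q; rewrite lee_fin (ltW xq) ltry.
- move=> _; have /rat_in_itvoo[q] : y - 1 < y by rewrite gtrBl.
  by rewrite in_itv /= => /andP[_ qy]; exists q; rewrite leNye lte_fin qy.
- by move=> _; exists 0; rewrite leNye ltry.
Qed.

Section esssup_theory.
Context {d} {T : measurableType d} {R : realType}.
Variable mu : {measure set T -> \bar R}.
Hypothesis mu_sfin : sigma_finite setT mu.
Implicit Types S : set (T -> \bar R).
Local Open Scope ereal_scope.

(* The least measurable upper bound is a countable infimum of measurable upper
   bounds [g] chosen to minimise [mu (F k `&` [set w | q < g w])] for all pieces
   [F k] of finite measure and all rational [q]. *)
Lemma ex_is_esssup S : exists g, is_esssup mu S g.
Proof.
have [F FT Ffin] := mu_sfin.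
pose U : set (T -> \bar R) :=
  [set g | measurable_fun setT g /\ forall h, S h -> ae_le mu h g].
pose lev (i : nat * rat) (g : T -> \bar R) : \bar R :=
  mu (F i.1 `&` [set w | (ratr i.2)%:E < g w]).
have mlev i (g : T -> \bar R) : measurable_fun setT g ->
    measurable (F i.1 `&` [set w | (ratr i.2)%:E < g w]).
  move=> mg; apply: measurableI; first exact: (Ffin _).1.
  rewrite -[X in measurable X]setTI; apply: measurable_lte => //.
have lev_fin i (g : T -> \bar R) : measurable_fun setT g -> lev i g < +oo.
  move=> mg; apply: le_lt_trans (Ffin i.1).2.
  by apply: le_measure; rewrite ?inE; [exact: mlev|exact: (Ffin _).1|exact: subIsetl].
pose m i := ereal_inf [set lev i g | g in U].
have m_fin i : m i \is a fin_num.
  rewrite ge0_fin_numE.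
    apply: (@le_lt_trans _ _ (lev i (cst +oo))); last by apply: lev_fin.
    apply: ereal_inf_lbound; exists (cst +oo) => //; split => // h _.
    by apply: aeW => w; exact: leey.
  by apply: le_ereal_inf_tmp => _ [g _ <-]; exact: measure_ge0.
have /choice[G GP] : forall i : nat * rat * nat,
    exists g, U g /\ lev i.1 g < m i.1 + (i.2.+1%:R^-1)%:E.
  move=> i; have e0 : (0 < i.2.+1%:R^-1 :> R)%R by rewrite invr_gt0.
  by have [_ [g Ug <-] glt] := lb_ereal_inf_adherent e0 (m_fin i.1); exists g.
(* Integers that code no index get the trivial upper bound [+oo], which leaves the infimum
   unchanged. *)
pose H n := if unpickle n is Some i then G i else cst +oo.
have UH n : U (H n).
  rewrite /H; case: (unpickle n) => [i|]; first exact: (GP i).1.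
  by split => // h _; apply: aeW => w; exact: leey.
pose gs w := einfs (H ^~ w) 0%N.
have gsH n w : gs w <= H n w by apply: ereal_inf_lbound; exists n.
have mgs : measurable_fun setT gs.
  by apply: measurable_fun_einfs => n; exact: (UH n).1.
have Ugs : U gs.
  split=> // h Sh.
  have /ae_foralln : forall n, ae_le mu h (H n) by move=> n; exact: (UH n).2.
  by apply: filterS => w hw; apply: le_ereal_inf_tmp => _ [n _ <-].
have lev_gs i : lev i gs <= m i.
  apply/lee_addgt0Pr => e e0.
  have [n ne] : exists n : nat, (n.+1%:R^-1 < e)%R.
    by have [n] := ltr_add_invr e0; rewrite add0r; exists n.
  apply: (@le_trans _ _ (lev i (G (i, n)))).
    apply: le_measure; rewrite ?inE; [exact: mlev|apply: mlev; exact: (GP _).1.1|].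
    move=> w [Fw /= qw]; split => //=; apply: (lt_le_trans qw).
    by have := gsH (pickle (i, n)) w; rewrite /H pickleK.
  by apply: le_trans (ltW (GP (i, n)).2) _; rewrite leeD2l // lee_fin ltW.
exists gs; split=> //; first exact: Ugs.2.
move=> g' mg' ubg'.
(* The minimum [h] is again an upper bound, so [lev i h >= m i >= lev i gs]. As [h <= gs] and the
   levels are finite, the sets where [gs] and [h] exceed a rational agree on each piece up to a null
   set. *)
pose h w := mine (gs w) (g' w).
have Uh : U h.
  split=> [|k Sk]; first exact: measurable_mine.
  by apply: filterS2 (Ugs.2 k Sk) (ubg' k Sk) => w; rewrite /h le_min => -> ->.
have null (i : nat * rat) :
    {ae mu, forall w, ~ (F i.1 w /\ g' w <= (ratr i.2)%:E < gs w)}.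
  exists ((F i.1 `&` [set w | (ratr i.2)%:E < gs w]) `\`
          (F i.1 `&` [set w | (ratr i.2)%:E < h w])); split.
  - by apply: measurableD; apply: mlev => //; exact: Uh.1.
  - rewrite measureD; [|exact: mlev|exact: mlev Uh.1|exact: lev_fin].
    rewrite (@setIidr _ (F i.1 `&` [set w | (ratr i.2)%:E < gs w])); last first.
      by move=> w [Fw /= qh]; split => //=; rewrite (lt_le_trans qh) // ge_min lexx.
    change (lev i gs - lev i h = 0).
    have lh : m i <= lev i h by apply: ereal_inf_lbound; exists h.
    have -> : lev i gs = lev i h.
      apply/eqP; rewrite eq_le (le_trans (lev_gs i) lh) /=.
      apply: le_measure; rewrite ?inE; [exact: mlev Uh.1|exact: mlev|].
      by move=> w [Fw /= qh]; split => //=; rewrite (lt_le_trans qh) // ge_min lexx.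
    rewrite subee // ge0_fin_numE ?measure_ge0 //; exact: lev_fin Uh.1.
  - move=> w /= /contrapT[Fw /andP[gq qgs]]; split; first by split.
    by move=> [_ /=]; rewrite /h lt_min ltNge (ltNge _ (g' w)) gq andbF.
(* Wherever [g' w < gs w], a rational in between and a piece containing [w] put [w] in one of these
   countably many null sets. *)
have := ae_forall_countType null; apply: filterS => w nw.
rewrite leNgt; apply/negP => /lte_rat_between[q qP].
have [k _ Fk] : (\bigcup_k F k) w by rewrite -FT.
exact: (nw (k, q)).
Qed.

Lemma ex_is_essinf S : exists g, is_essinf mu S g.
Proof.
have [g [mg ubg lubg]] := ex_is_esssup [set (fun w => - h w) | h in S].
exists (fun w => - g w); split.
- exact: measurableT_comp.
- by move=> h Sh; apply: filterS (ubg _ (imageP _ Sh)) => w; rewrite leeNl.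
- move=> g' mg' lbg'; have : ae_le mu g (fun w => - g' w).
    apply: lubg => [|_ [h Sh <-]]; first exact: measurableT_comp.
    by apply: filterS (lbg' h Sh) => w; rewrite leeN2.
  by apply: filterS => w; rewrite leeNr.
Qed.

Lemma esssupP S : is_esssup mu S (esssup mu S).
Proof. exact: (@xgetPex _ _ (is_esssup mu S)) (ex_is_esssup S). Qed.

Lemma essinfP S : is_essinf mu S (essinf mu S).
Proof. exact: (@xgetPex _ _ (is_essinf mu S)) (ex_is_essinf S). Qed.

End esssup_theory.

(** * Strongly measurable functions *)

Lemma measurable_mem d (T : measurableType d) (B : set T) :
  measurable B -> measurable_fun setT (fun w => w \in B).
Proof.
move=> mB; apply: (measurable_fun_bool true); rewrite setTI.
rewrite (_ : _ @^-1` _ = B) //.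
by apply/seteqP; split=> w /=; [exact: set_mem|exact: mem_set].
Qed.

(** The inverse of [g] is [g] times the square of the real power [|g|^(-1)], and real powers are
    measurable. At zeros of [g] both sides are 0. *)
Lemma measurable_funV d (T : measurableType d) (R : realType) (g : T -> R) :
  measurable_fun setT g -> measurable_fun setT (fun w => (g w)^-1).
Proof.
move=> mg; rewrite (_ : (fun w => _) =
    (fun w => g w * (powR `|g w| (-1) * powR `|g w| (-1)))); last first.
  apply/funext => w; rewrite powR_inv1 // -invfM -normrM ger0_norm -?expr2 ?sqr_ge0 //.
  have [->|g0] := eqVneq (g w) 0; first by rewrite invr0 mul0r.
  by field.
have mn : measurable_fun setT (fun w => `|g w|) by exact: measurableT_comp.
have mp : measurable_fun setT (fun w => powR `|g w| (-1)).
  exact: (measurableT_comp (measurable_powR _) mn).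
by apply: measurable_funM => //; exact: measurable_funM.
Qed.

Section L0_theory.
Context {d} {T : measurableType d} {R : realType}.
Variable mu : {measure set T -> \bar R}.

Lemma simple_fun2 (X Y Z : normedModType R) (op : X -> Y -> Z)
    (s : T -> X) (t : T -> Y) : simple_fun s -> simple_fun t ->
  simple_fun (fun w => op (s w) (t w)).
Proof.
move=> [fs ms] [ft mt]; split.
  apply: (sub_finite_set (B := (fun p => op p.1 p.2) @` (range s `*` range t))).
    by move=> _ [w _ <-]; exists (s w, t w) => //; split; exists w.
  by apply: finite_image; exact: finite_setX.
move=> z.
rewrite (_ : _ @^-1` _ = \bigcup_(p in range s `*` range t)
    (if op p.1 p.2 == z then s @^-1` [set p.1] `&` t @^-1` [set p.2] else set0)).
  apply: fin_bigcup_measurable; first exact: finite_setX.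
  by move=> p _; case: ifP => // _; apply: measurableI.
apply/seteqP; split => [w <-|w [p _]]; last by case: eqP => // <- [/= -> ->].
by exists (s w, t w); [split; exists w|rewrite /= eqxx].
Qed.

Lemma simple_fun_cst (X : normedModType R) (x : X) : simple_fun (cst x : T -> X).
Proof.
split=> [|y]; first by apply: (sub_finite_set (B := [set x])) => // _ [w _ <-].
by rewrite preimage_cst; case: ifP.
Qed.

Lemma L0_cst (X : normedModType R) (x : X) : L0 mu X (cst x).
Proof.
exists (fun=> cst x); split=> [_|]; first exact: simple_fun_cst.
by apply: aeW => w; exact: cvg_cst.
Qed.

Lemma L0D (X : normedModType R) (y z : T -> X) :
  L0 mu X y -> L0 mu X z -> L0 mu X (fun w => y w + z w).
Proof.
move=> [s [sS sy]] [t [tS tz]].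
exists (fun n w => s n w + t n w); split=> [n|]; first exact: simple_fun2.
by apply: filterS2 sy tz => w; exact: cvgD.
Qed.

Lemma L0_sum (X : normedModType R) (n : nat) (y : 'I_n -> T -> X) :
  (forall i, L0 mu X (y i)) -> L0 mu X (fun w => \sum_(i < n) y i w).
Proof.
elim: n y => [|n IHn] y Ly.
  by under eq_fun do rewrite big_ord0; exact: L0_cst.
under eq_fun do rewrite big_ord_recr /=.
by apply: L0D => //; exact: IHn.
Qed.

Lemma L0_measurable (a : T -> R) : measurable_fun setT a -> L0 mu R a.
Proof.
move=> ma; have /measurable_EFinP ma' := ma.
have [s sa] := approximation_sfun measurableT ma'.
exists (fun n => s n); split=> [n|].
  split; first exact: fimfunP.
  by move=> x; rewrite -[X in measurable X]setTI; exact: measurable_funP.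
by apply: aeW => w; exact: fine_cvg (sa w Logic.I).
Qed.

Lemma L0Z (X : normedModType R) (a : T -> R) (y : T -> X) :
  measurable_fun setT a -> L0 mu X y -> L0 mu X (fun w => a w *: y w).
Proof.
move=> /L0_measurable[s [sS sa]] [t [tS ty]].
exists (fun n w => s n w *: t n w); split=> [n|]; first exact: (simple_fun2 (X := R)).
by apply: filterS2 sa ty => w; exact: cvgZ.
Qed.

Lemma simple_measurable (a : T -> R) : simple_fun a -> measurable_fun setT a.
Proof.
move=> [fa ma] _ B mB; rewrite setTI.
rewrite (_ : _ @^-1` _ = \bigcup_(x in range a `&` B) a @^-1` [set x]).
  by apply: fin_bigcup_measurable => //; exact: finite_setIl.
apply/seteqP; split => [w Bw|w [x [_ Bx] /= ->] //].
by exists (a w) => //; split => //; exists w.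
Qed.

Hypothesis mu_complete : measure_is_complete mu.

(** The function [a] agrees a.e. with the upper limit of its simple approximations, which is defined
    everywhere and measurable; completeness of [mu] carries measurability over to [a]. *)
Lemma measurable_L0 (a : T -> R) : L0 mu R a -> measurable_fun setT a.
Proof.
move=> [s [sS sa]]; apply/measurable_EFinP.
apply: (ae_measurable_fun mu_complete
  (f := fun w => limn_esup (fun n => (s n w)%:E))).
  apply: filterS sa => w sw _ /=.
  have sEw : (s n w)%:E @[n --> \oo] --> (a w)%:E by apply/cvg_EFin => //; exact: nearW.
  rewrite is_cvg_limn_esupE; first exact: cvg_lim sEw.
  exact: cvgP sEw.
apply: measurable_fun_limn_esup => n; apply/measurable_EFinP.
exact: simple_measurable.
Qed.

End L0_theory.
(** * A conditional sandwich theorem *)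

(** The weight [L] makes [L * t + (1 - L) * t'] vanish, and the hypothesis at [q = L] would be the
    claim with denominators cleared. Since [L] may be irrational, a rational [q] slightly above it
    is used. *)
Lemma slope_le_rational (R : realType) (p p' t t' g : R) :
  0 < t -> t' < 0 ->
  (forall q : rat, 0 <= (ratr q : R) <= 1 ->
    g - `|ratr q * t + (1 - ratr q) * t'| <= ratr q * p + (1 - ratr q) * p') ->
  (p' - g) / t' <= (p - g) / t.
Proof.
move=> t0 t'0 hq.
rewrite ler_pdivlMr // mulrAC ler_ndivrMr //.
rewrite leNgt; apply/negP => gap.
pose D := t - t'; have D0 : 0 < D by rewrite /D; lra.
pose L := - t' / D; have LD : L * D = - t' by rewrite /L divfK // gt_eqF.
have L0 : 0 < L by rewrite /L divr_gt0 // oppr_gt0.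
have L1 : L < 1 by rewrite /L ltr_pdivrMr // /D; lra.
(* [C] bounds the rate at which the hypothesis changes as [q] moves up from [L], so a move shorter
   than [e] cannot make up for the assumed gap [e * C]. *)
pose C := `|p - p'| + D; have C0 : 0 < C by rewrite /C ltr_wpDl.
pose e := (g - (L * p + (1 - L) * p')) / C.
have eC : e * C = g - (L * p + (1 - L) * p') by rewrite /e divfK // gt_eqF.
have e0 : 0 < e.
  rewrite /e divr_gt0 // -(pmulr_lgt0 _ D0).
  have -> : (g - (L * p + (1 - L) * p')) * D =
     g * D - ((L * D) * p + (D - L * D) * p') by ring.
  by rewrite LD /D; nra.
have /rat_in_itvoo[q] : L < Num.min 1 (L + e) by rewrite lt_min L1 ltrDl.
rewrite in_itv /= lt_min => /andP[Lq /andP[q1 qLe]].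
have := hq q; rewrite (ltW (lt_trans L0 Lq)) (ltW q1) => /(_ isT).
have -> : ratr q * t + (1 - ratr q) * t' = (ratr q - L) * D.
  have -> : (ratr q - L) * D = ratr q * D - L * D by ring.
  by rewrite LD /D; ring.
rewrite ger0_norm; last by apply: mulr_ge0; [rewrite subr_ge0|]; exact: ltW.
have h1 : (ratr q - L) * (p - p') <= (ratr q - L) * `|p - p'|.
  by rewrite ler_wpM2l ?ler_norm // subr_ge0 ltW.
have h2 : (ratr q - L) * C < e * C by rewrite ltr_pM2r //; lra.
move: h2; rewrite eC /C; lra.
Qed.

Lemma convex_comb_addEFin (R : realType) (k : R) (p p1 p2 : \bar R) (s s1 s2 : R) :
  (p <= k%:E * p1 + (1 - k)%:E * p2)%E -> s <= k * s1 + (1 - k) * s2 ->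
  (p + s%:E <= k%:E * (p1 + s1%:E) + (1 - k)%:E * (p2 + s2%:E))%E.
Proof.
move=> pk sk; rewrite !muleDr //; last 2 first.
- by rewrite fin_num_adde_defl.
- by rewrite fin_num_adde_defl.
by rewrite addeACA leeD // -!EFinM -EFinD lee_fin.
Qed.

Section sandwich.
Context {d} {T : measurableType d} {R : realType}.
Variable mu : {measure set T -> \bar R}.
Hypothesis mu_sfin : sigma_finite setT mu.
Variable X : lmodType R.

(** The exceptional null set may depend on [x], [y] and [k]. For fixed points, convexity is
    therefore used pointwise in [w] only for countably many weights. *)
Definition ae_convex (F : X -> T -> \bar R) :=
  forall (x y : X) (k : R), 0 <= k <= 1 -> {ae mu, forall w,
    (F (k *: x + (1 - k) *: y)%R w <= k%:E * F x w + (1 - k)%:E * F y w)%E}.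

Definition affine_family (u : X -> T -> R) :=
  forall (x y : X) (k : R) (w : T),
    u (k *: x + (1 - k) *: y) w = k * u x w + (1 - k) * u y w.

(* Bounds on [a] that express [g + a * t <= p]; the defaults [1] and [-1] apply
   when the sign of [t] imposes no constraint on that side. *)
Definition upper_slope (g t : R) (p : \bar R) : \bar R :=
  (if (0 < t)%R then (p - g%:E) * t^-1%:E else 1)%E.

Definition lower_slope (g t : R) (p : \bar R) : \bar R :=
  (if (t < 0)%R then (p - g%:E) * t^-1%:E else -1)%E.

(** The slope -1 meets every constraint coming from [t > 0], since there [g - |t| = g - t];
    symmetrically, the slope 1 meets those coming from [t < 0]. These bounds later keep the chosen
    slope finite. *)
Lemma upper_slope_ge (g t : R) (p : \bar R) :
  ((g - `|t|)%:E <= p)%E -> (-1 <= upper_slope g t p)%E.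
Proof.
rewrite /upper_slope; case: ltP => [t0|_ _]; last by rewrite -EFinN lee_fin; lra.
case: p => [p| |//]; last first.
  by rewrite addye // gt0_mulye ?leey // lte_fin invr_gt0.
rewrite !lee_fin gtr0_norm // => gp.
by rewrite ler_pdivlMr //; lra.
Qed.

Lemma lower_slope_le (g t : R) (p : \bar R) :
  ((g - `|t|)%:E <= p)%E -> (lower_slope g t p <= 1)%E.
Proof.
rewrite /lower_slope; case: ltP => [t0|_ _]; last by rewrite -EFinN lee_fin; lra.
case: p => [p| |//]; last first.
  by rewrite addye // lt0_mulye ?leNye // lte_fin invr_lt0.
rewrite !lee_fin ltr0_norm // => gp.
by rewrite ler_ndivrMr //; lra.
Qed.

(** For [t' < 0 < t] and finite values this compares difference quotients on both sides of 0. An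
    infinite value makes its bound vacuous, and a default is handled by the bounds -1 and 1. *)
Lemma lower_le_upper_slope (g t t' : R) (p p' : \bar R) :
  ((g - `|t|)%:E <= p)%E -> ((g - `|t'|)%:E <= p')%E ->
  (forall q : rat, 0 <= (ratr q : R) <= 1 ->
    ((g - `|ratr q * t + (1 - ratr q) * t'|)%:E <=
      (ratr q)%:E * p + (1 - ratr q)%:E * p')%E) ->
  (lower_slope g t' p' <= upper_slope g t p)%E.
Proof.
move=> gp gp' hq.
have [t0|t0] := ltP 0 t; last first.
  by rewrite [upper_slope _ _ _]/upper_slope ltNge t0; exact: lower_slope_le.
have [t'0|t'0] := ltP t' 0; last first.
  by rewrite /lower_slope ltNge t'0; exact: upper_slope_ge.
rewrite /lower_slope /upper_slope t0 t'0.
case: p gp hq => [p| |//] gp hq; last first.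
  by rewrite (@addye _ (- _)) // gt0_mulye ?leey // lte_fin invr_gt0.
case: p' gp' hq => [p'| |//] gp' hq; last first.
  by rewrite (@addye _ (- _)) // lt0_mulye ?leNye // lte_fin invr_lt0.
by rewrite lee_fin; apply: slope_le_rational => // q /hq; rewrite lee_fin.
Qed.

Lemma between_slopes (g t a : R) (p : \bar R) :
  ((g - `|t|)%:E <= p)%E -> (lower_slope g t p <= a%:E <= upper_slope g t p)%E ->
  ((g + a * t)%:E <= p)%E.
Proof.
rewrite /lower_slope /upper_slope.
case: p => [p| |//]; last by move=> _ _; rewrite leey.
case: (ltgtP 0 t) => [t0 _|t0 _|<-]; last 1 first.
- by rewrite normr0 subr0 mulr0 addr0.
- by move=> /andP[_]; rewrite !lee_fin ler_pdivlMr //; lra.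
- by move=> /andP[+ _]; rewrite !lee_fin ler_ndivrMr //; lra.
Qed.

Variable g : T -> R.
Hypothesis mg : measurable_fun setT g.

(** The slope is the essential infimum of the upper slopes. Each lower slope is a.e. below each
    upper slope, hence a.e. below this infimum, although the family of points is uncountable. *)
Lemma ex_ae_slope (F : X -> T -> \bar R) (u : X -> T -> R) :
  (forall x, measurable_fun setT (F x)) -> (forall x, measurable_fun setT (u x)) ->
  ae_convex F -> affine_family u ->
  (forall x, {ae mu, forall w, ((g w - `|u x w|)%:E <= F x w)%E}) ->
  exists a : T -> R, measurable_fun setT a /\
    forall x, {ae mu, forall w, ((g w + a w * u x w)%:E <= F x w)%E}.
Proof.
move=> mF mu_ convF affu lbF.
(* Adjoining the constant 1 bounds the infimum [a0] from above; with the lower bound -1 it is a.e.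
   finite. *)
pose S : set (T -> \bar R) :=
  [set fun w => upper_slope (g w) (u x w) (F x w) | x in setT] `|` [set cst 1%:E].
have [ma0 lba0 glba0] := essinfP mu_sfin S.
set a0 := essinf mu S in ma0 lba0 glba0.
have mq x : measurable_fun setT (fun w => (F x w - (g w)%:E) * (u x w)^-1%:E)%E.
  apply: emeasurable_funM; last exact/measurable_EFinP/measurable_funV.
  by apply: emeasurable_funB => //; exact/measurable_EFinP.
have ge_m1 : ae_le mu (cst (-1)%:E) a0.
  apply: glba0 => // h [[x _ <-]|->]; last by apply: aeW => w; rewrite lee_fin; lra.
  by apply: filterS (lbF x) => w; exact: upper_slope_ge.
have ge_lower x : ae_le mu (fun w => lower_slope (g w) (u x w) (F x w)) a0.
  apply: glba0.
    apply: measurable_fun_ifT => //.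
    rewrite (_ : (fun w => _) = (fun w => (u x w)%:E < 0%:E)%E); last first.
      by apply/funext => w; rewrite lte_fin.
    by apply: measurable_fun_lte => //; exact/measurable_EFinP.
  move=> h [[z _ <-]|->]; last first.
    by apply: filterS (lbF x) => w; exact: lower_slope_le.
  have /ae_forall_countType mixF : forall q : rat, {ae mu, forall w,
      0 <= (ratr q : R) <= 1 ->
      ((g w - `|ratr q * u z w + (1 - ratr q) * u x w|)%:E <=
        (ratr q)%:E * F z w + (1 - ratr q)%:E * F x w)%E}.
    move=> q; have [q01|q01] := boolP (0 <= (ratr q : R) <= 1); last exact: aeW.
    apply: filterS2 (convF z x _ q01) (lbF (ratr q *: z + (1 - ratr q) *: x)).
    by move=> w cw lw _; rewrite -affu; exact: le_trans lw cw.
  apply: filterS3 mixF (lbF z) (lbF x) => w mixw lz lx.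
  exact: lower_le_upper_slope.
have le_1 : ae_le mu a0 (cst 1%:E) by apply: lba0; right.
exists (fun w => fine (a0 w)); split; first exact: measurableT_comp.
move=> x; have le_upper : ae_le mu a0 (fun w => upper_slope (g w) (u x w) (F x w)).
  by apply: lba0; left; exists x.
apply: filterS2 (filterI (lbF x) (filterI ge_m1 le_1))
  (filterI (ge_lower x) le_upper) => w [lw [g1 l1]] [lo up].
apply: between_slopes => //; rewrite fineK ?lo //.
by rewrite fin_numElt (lt_le_trans _ g1) ?ltNyr // (le_lt_trans l1) ?ltry.
Qed.

(** By induction on [n]. Adding the first [n] absolute values to [F] keeps it convex and leaves a
    one-dimensional problem for [u n]. Subtracting the affine term [c * u n] so obtained again keeps
    [F] convex, and only [n] absolute values remain. *)
Lemma ae_sandwich (n : nat) (u : nat -> X -> T -> R) (F : X -> T -> \bar R) :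
  (forall x, measurable_fun setT (F x)) ->
  (forall i x, measurable_fun setT (u i x)) ->
  ae_convex F -> (forall i, affine_family (u i)) ->
  (forall x, {ae mu, forall w, ((g w - \sum_(i < n) `|u i x w|)%:E <= F x w)%E}) ->
  exists a : nat -> T -> R, (forall i, measurable_fun setT (a i)) /\
    forall x, {ae mu, forall w, ((g w + \sum_(i < n) a i w * u i x w)%:E <= F x w)%E}.
Proof.
elim: n F => [|n IHn] F mF mu_ convF affu lbF.
  exists (fun _ => cst 0); split=> // x.
  by apply: filterS (lbF x) => w; rewrite !big_ord0 subr0 addr0.
pose s x w := \sum_(i < n) `|u i x w|.
have ms x : measurable_fun setT (s x).
  by apply: measurable_sum => i; exact: measurableT_comp.
have [|||||c [mc cF]] := @ex_ae_slope (fun x w => F x w + (s x w)%:E)%E (u n).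
- by move=> x; apply: emeasurable_funD => //; exact/measurable_EFinP.
- by [].
- move=> x y k k01; apply: filterS (convF x y k k01) => w Fw.
  apply: convex_comb_addEFin => //.
  rewrite /s !mulr_sumr -big_split /=; apply: ler_sum => i _.
  have [k0 k1] := andP k01.
  rewrite affu (le_trans (ler_normD _ _)) // !normrM (ger0_norm k0).
  by rewrite [`|1 - k|]ger0_norm // subr_ge0.
- exact: affu.
- move=> x; apply: filterS (lbF x) => w.
  by rewrite big_ord_recr /= -leeBlDr // -EFinB opprD addrA addrAC.
have [|||||a [ma aF]] := IHn (fun x w => F x w + (- (c w * u n x w))%:E)%E.
- move=> x; apply: emeasurable_funD => //; apply/measurable_EFinP.
  by apply: measurableT_comp => //; exact: measurable_funM.
- exact: mu_.
- move=> x y k k01; apply: filterS (convF x y k k01) => w Fw.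
  by apply: convex_comb_addEFin => //; rewrite affu; lra.
- exact: affu.
- move=> x; apply: filterS (cF x) => w.
  rewrite -leeBlDr // -EFinB /s => h; rewrite -leeBlDr // -EFinB opprK.
  by rewrite addrAC.
exists (fun i => if i == n then c else a i); split=> [i|x]; first by case: ifP.
apply: filterS (aF x) => w; rewrite -leeBlDr // -EFinB opprK => h.
rewrite big_ord_recr /= eqxx addrA.
rewrite (eq_bigr (fun i : 'I_n => a i w * u i x w)) // => i _.
by rewrite ltn_eqF.
Qed.

End sandwich.

(** * Affine minorants *)

Section pairing.
Context {d} {T : measurableType d} {R : realType}.
Variable mu : {measure set T -> \bar R}.
Hypothesis mu_complete : measure_is_complete mu.
Hypothesis mu_sfin : sigma_finite setT mu.
Variables X Y : normedModType R.
Variable b : {bilinear X -> Y -> R | *%R & *%R}.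
Hypothesis b_norm : forall x y, `|b x y| <= `|x| * `|y|.

Lemma pairingZl (k : R) x y : b (k *: x) y = k * b x y.
Proof. exact: linearZl_LR. Qed.

Lemma pairingZr (k : R) x y : b x (k *: y) = k * b x y.
Proof. exact: linearZr_LR. Qed.

Lemma pairing_continuous x : continuous (b x : Y -> R).
Proof.
move=> y; apply/cvgrPdist_le => e e0.
(* The Lipschitz constant is raised to [|x| + 1] to allow division by it when [x = 0]. *)
have C0 : 0 < `|x| + 1 by rewrite ltr_wpDl.
near=> z.
rewrite -linearBr (le_trans (b_norm _ _)) //.
rewrite (@le_trans _ _ ((`|x| + 1) * (e / (`|x| + 1)))) //; last first.
  by rewrite mulrC divfK // gt_eqF.
apply: ler_pM => //; first by rewrite lerDl.
by near: z; apply: cvgr_dist_le; [exact: cvg_id|rewrite divr_gt0].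
Unshelve. all: by end_near. Qed.

Lemma measurable_pairing x (y : T -> Y) : L0 mu Y y ->
  measurable_fun setT (fun w => b x (y w)).
Proof.
move=> [s [sS sy]]; apply: (measurable_L0 mu_complete).
exists (fun n w => b x (s n w)); split=> [n|].
  (* The unary map [b x] enters the two-argument lemma with a dummy constant as first argument. *)
  exact: (simple_fun2 (X := R) (fun _ v => b x v) (s := cst 0) (simple_fun_cst _) (sS n)).
apply: filterS sy => w sw.
apply: (@continuous_cvg _ Y R _ _ (fun n => s n w) (b x : Y -> R) (y w)) => //.
exact: pairing_continuous.
Qed.

(** A sum in place of the maximum that the neighbourhoods suggest: its ball of radius [r] lies
    inside theirs, and a sum is what the sandwich theorem takes. *)
Definition seminorm_dist n (v : nat -> T -> Y) (z x : X) (w : T) : R :=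
  \sum_(i < n) `|b (z - x) (v i w)|.

Lemma measurable_seminorm_dist n v z x : (forall i, L0 mu Y (v i)) ->
  measurable_fun setT (seminorm_dist n v z x).
Proof.
move=> Lv; apply: measurable_sum => i.
by apply: measurableT_comp => //; exact: measurable_pairing.
Qed.

Lemma seminorm_dist_refl n v x w : seminorm_dist n v x x w = 0.
Proof.
by rewrite /seminorm_dist big1 // => i _; rewrite subrr linear0l normr0.
Qed.

Lemma seminorm_dist_ge0 n v z x w : 0 <= seminorm_dist n v z x w.
Proof. by apply: sumr_ge0 => i _. Qed.

Lemma seminorm_dist_triangle n v y z x w :
  seminorm_dist n v z x w <= seminorm_dist n v z y w + seminorm_dist n v y x w.
Proof.
rewrite /seminorm_dist -big_split /=; apply: ler_sum => i _.
by rewrite -{1}(subrK y z) -[_ - y + y - x]addrA linearDl ler_normD.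
Qed.

Lemma seminorm_dist_conv n v (k : R) z x w : 0 <= k ->
  seminorm_dist n v (k *: z + (1 - k) *: x) x w = k * seminorm_dist n v z x w.
Proof.
move=> k0; rewrite /seminorm_dist mulr_sumr; apply: eq_bigr => i _.
have -> : k *: z + (1 - k) *: x - x = k *: (z - x).
  by rewrite scalerBl scale1r scalerBr addrA addrAC addrK.
by rewrite pairingZl normrM ger0_norm.
Qed.

Variable f : X -> T -> \bar R.
Hypothesis f_meas : forall x, measurable_fun setT (f x).

Lemma fenchel_young x (y : T -> Y) :
  {ae mu, forall w, ((b x (y w))%:E - conjugate b mu f y w <= f x w)%E}.
Proof.
have [_ ub _] := esssupP mu_sfin [set (fun w => (b x (y w))%:E - f x w)%E | x in setT].
have /ub : [set (fun w => (b x (y w))%:E - f x w)%E | x in setT]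
  (fun w => (b x (y w))%:E - f x w)%E by exists x.
apply: filterS => w; rewrite -/(conjugate b mu f y).
by case: (f x w) => [p| |]; case: (conjugate b mu f y w) => [c| |] //=;
  rewrite ?leey ?leNye // !lee_fin; lra.
Qed.

Lemma measurable_conjugate y : measurable_fun setT (conjugate b mu f y).
Proof. by have [] := esssupP mu_sfin [set (fun w => (b x (y w))%:E - f x w)%E | x in setT]. Qed.

Hypothesis f_convex : proper_convex mu f.

Section minorant.
Variables (v v' : nat -> T -> Y) (n n' : nat).
Hypotheses (Lv : forall i, L0 mu Y (v i)) (Lv' : forall i, L0 mu Y (v' i)).
Variables (r r' m m' : T -> R).
Hypotheses (mr : measurable_fun setT r) (mr' : measurable_fun setT r').
Hypotheses (mm : measurable_fun setT m) (mm' : measurable_fun setT m').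
Hypotheses (r0 : {ae mu, forall w, 0 < r w}) (r'0 : {ae mu, forall w, 0 < r' w}).
Variable B : set T.
Hypothesis mB : measurable B.
Variables x x0 : X.
Hypothesis x0_dom : {ae mu, forall w, f x0 w \is a fin_num}.
Hypothesis le_m : forall z, {ae mu, forall w, B w ->
  seminorm_dist n v z x w <= r w -> ((m w)%:E <= f z w)%E}.
Hypothesis le_m' : forall z, {ae mu, forall w, B w ->
  seminorm_dist n' v' z x0 w <= r' w -> ((m' w)%:E <= f z w)%E}.

Let K w := (fine (f x0 w) - m' w) / r' w.

Let mK : measurable_fun setT K.
Proof.
apply: measurable_funM; last exact: measurable_funV.
by apply: measurable_funB => //; exact: measurableT_comp.
Qed.

(** The point [x0] lies in its own neighbourhood, whence [m' <= f x0] on [B]. *)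
Let K_ge0 : {ae mu, forall w, B w -> 0 <= K w}.
Proof.
apply: filterS3 (le_m' x0) x0_dom r'0 => w + fx0 r'w Bw.
rewrite seminorm_dist_refl => /(_ Bw (ltW r'w)); rewrite -(fineK fx0) lee_fin.
by move=> ?; rewrite divr_ge0 ?subr_ge0 // ltW.
Qed.

(* Convexity along the segments from [x0], where [f] is finite, turns the bound
   on a neighbourhood of [x0] into a global bound of linear growth. *)
Lemma linear_growth_minorant z : {ae mu, forall w, B w ->
  ((m' w - K w * seminorm_dist n' v' z x0 w)%:E <= f z w)%E}.
Proof.
have [f_gt f_dom f_conv] := f_convex.
(* Countably many weights share one null set, so the weight may be chosen separately at each [w]. *)
pose k (j : nat) : R := j.+1%:R^-1.
have k0 j : 0 < k j by rewrite /k invr_gt0.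
have k1 j : k j <= 1 by rewrite /k invf_le1 // ler1n.
have kc j : 0 <= k j <= 1 by rewrite ltW //= k1.
have /ae_foralln conv : forall j, {ae mu, forall w,
   B w -> k j * seminorm_dist n' v' z x0 w <= r' w ->
    ((m' w)%:E <= (k j)%:E * f z w + (1 - k j)%:E * f x0 w)%E}.
  move=> j; apply: filterS2 (f_conv z x0 _ (kc j))
    (le_m' (k j *: z + (1 - k j) *: x0)) => w fc lw Bw kr.
  apply: le_trans fc; apply: lw => //.
  by rewrite seminorm_dist_conv // ltW.
apply: filterS3 (filterI conv K_ge0) (filterI (f_gt z) x0_dom) r'0.
move=> w [cw Kw] [fz fx0] r'w Bw; have {}Kw := Kw Bw.
(* Let [j] be the integer part of [P / r']. Then [P / r' < j + 1] puts the point of weight [k j] on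
   the segment into the ball around [x0], and [j <= P / r'] makes the resulting bound linear in
   [P]. *)
have := cw (Num.truncn (seminorm_dist n' v' z x0 w / r' w)) Bw.
set j := Num.truncn _; set P := seminorm_dist _ _ _ _ _.
have P0 : 0 <= P / r' w by rewrite divr_ge0 ?seminorm_dist_ge0 // ltW.
have := truncn_itv P0; rewrite -/j => /andP[jP Pj].
move: Kw; rewrite /K -(fineK fx0) /=; set p0 := fine _ => Kw.
have gap0 : 0 <= p0 - m' w.
  by move: Kw; rewrite pmulr_lge0 // invr_gt0.
case: (f z w) fz => [p _| |//]; last by rewrite leey.
have kP : k j * P <= r' w.
  by rewrite /k mulrC ler_pdivrMr // mulrC -ler_pdivrMr // ltW.
move=> /(_ kP); rewrite !lee_fin => h.
have kj : k j * j.+1%:R = 1 by rewrite /k mulVf.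
have h2 : m' w * j.+1%:R <= (k j * p + (1 - k j) * p0) * j.+1%:R.
  by rewrite ler_pM2r.
have h3 : (k j * p + (1 - k j) * p0) * j.+1%:R =
    (k j * j.+1%:R) * p + (j.+1%:R - k j * j.+1%:R) * p0 by ring.
move: h2; rewrite h3 kj -natr1 => h2.
have : (p0 - m' w) * j%:R <= (p0 - m' w) * (P / r' w) by rewrite ler_wpM2l.
have -> : (p0 - m' w) / r' w * P = (p0 - m' w) * (P / r' w) by rewrite mulrAC mulrA.
lra.
Qed.

(** Chosen so that [K2 * r] covers the drop from [m] to the linear growth bound at [x]; the maximum
    with 0 keeps the penalty nonnegative. *)
Let K2 w := Num.max 0
  ((m w - (m' w - K w * seminorm_dist n' v' x x0 w)) / r w).

Let mK2 : measurable_fun setT K2.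
Proof.
apply: (measurable_maxr (f := cst 0)) => //.
apply: measurable_funM; last exact: measurable_funV.
apply: measurable_funB => //; apply: measurable_funB => //.
by apply: measurable_funM => //; exact: measurable_seminorm_dist.
Qed.

(** Inside the ball of radius [r] around [x] the bound [m] applies. Outside it, the linear growth
    bound is recentred from [x0] to [x] by the triangle inequality, and the distance to [x] exceeds
    [r], so the [K2] term covers the loss. *)
Lemma combined_minorant z : {ae mu, forall w, B w ->
  ((m w - (K2 w * seminorm_dist n v z x w + K w * seminorm_dist n' v' z x w))%:E
    <= f z w)%E}.
Proof.
apply: filterS3 (filterI (le_m z) (linear_growth_minorant z)) K_ge0 r0.
move=> w [lm lg] Kw rw Bw.
have {}Kw := Kw Bw; have {}lm := lm Bw; have {}lg := lg Bw.
have P'0 : 0 <= K w * seminorm_dist n' v' z x w by rewrite mulr_ge0 ?seminorm_dist_ge0.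
have P0 := seminorm_dist_ge0 n v z x w.
have K20 : 0 <= K2 w by rewrite le_max lexx.
have [Pr|rP] := leP (seminorm_dist n v z x w) (r w).
  apply: le_trans (lm Pr); rewrite lee_fin.
  have : 0 <= K2 w * seminorm_dist n v z x w by exact: mulr_ge0.
  by lra.
apply: le_trans lg; rewrite lee_fin.
have tri : K w * seminorm_dist n' v' z x0 w <= K w *
    (seminorm_dist n' v' z x w + seminorm_dist n' v' x x0 w).
  by rewrite ler_wpM2l // seminorm_dist_triangle.
have K2r : m w - (m' w - K w * seminorm_dist n' v' x x0 w) <= K2 w * r w.
  by rewrite -ler_pdivrMr // le_max lexx orbT.
have K2P : K2 w * r w <= K2 w * seminorm_dist n v z x w.
  by rewrite ler_wpM2l // ltW.
move: tri; rewrite mulrDr; lra.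
Qed.

Lemma ex_dual_minorant : exists y : T -> Y, L0 mu Y y /\
  {ae mu, forall w, B w -> ((m w)%:E <= (b x (y w))%:E - conjugate b mu f y w)%E}.
Proof.
have [f_gt f_dom f_conv] := f_convex.
(* The random slopes are absorbed into the dual elements, so the penalty becomes a plain sum of
   absolute values. *)
pose V i w := if (i < n)%N then K2 w *: v i w else K w *: v' (i - n)%N w.
have LV i : L0 mu Y (V i).
  by rewrite /V; case: ltnP => _; exact: L0Z.
(* The value [+oo] off [B] turns bounds valid on [B] into bounds valid a.e. and preserves
   convexity. *)
pose F z w := if w \in B then f z w else +oo%E.
have [|||||a [ma aF]] := @ae_sandwich _ _ _ _ mu_sfin X m mm (n + n')
    (fun i z w => b (z - x) (V i w)) F.
- move=> z; apply: measurable_fun_ifT => //.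
  exact: measurable_mem.
- by move=> i z; exact: measurable_pairing.
- move=> y z k k01; apply: filterS (f_conv y z k k01) => w fw.
  rewrite /F; case: ifP => // _; have /andP[k0 k1] := k01.
  (* The weight 0 is separate because [0 * +oo = 0]. *)
  have [->|kn0] := eqVneq k 0; first by rewrite subr0 mul0e mul1e add0e.
  have kp : 0 < k by rewrite lt_def kn0.
  rewrite gt0_muley ?lte_fin // addye ?leey //.
  by rewrite gt_eqF // (lt_le_trans ltNy0) // mule_ge0 // lee_fin subr_ge0.
- move=> i y z k w; rewrite -!pairingZl -linearDl; congr (b _ _).
  rewrite !scalerBr addrACA -opprD -scalerDl.
  by rewrite addrCA subrr addr0 scale1r.
- move=> z; apply: filterS2 (combined_minorant z) K_ge0 => w cw Kw.
  rewrite /F; case: ifPn; last by move=> _; rewrite leey.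
  rewrite in_setE => Bw; apply: le_trans (cw Bw); rewrite lee_fin lerB //.
  rewrite big_split_ord /= /seminorm_dist !mulr_sumr; apply: lerD.
    apply: ler_sum => i _; rewrite /V ltn_ord pairingZr normrM ger0_norm //.
    by rewrite le_max lexx.
  apply: ler_sum => i _; rewrite /V ltnNge leq_addr /= pairingZr normrM.
  by rewrite addKn ger0_norm // Kw.
pose y w := \sum_(i < n + n') a i w *: V i w.
have Ly : L0 mu Y y by apply: L0_sum => i; exact: L0Z.
exists y; split=> //.
have by_sum z w : b z (y w) = \sum_(i < n + n') a i w * b z (V i w).
  by rewrite linear_sumr; apply: eq_bigr => i _; rewrite pairingZr.
have [_ _ lub] := esssupP mu_sfin [set (fun w => (b x (y w))%:E - f x w)%E | x in setT].
(* The sandwich inequality [m + <z - x, y> <= f z] rearranges to [<z, y> - f z <= <x, y> - m] for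
   every [z], which bounds the conjugate on [B]. *)
have : ae_le mu (conjugate b mu f y)
    (fun w => if w \in B then (b x (y w) - m w)%:E else +oo%E).
  apply: lub.
    apply: measurable_fun_ifT => //.
      exact: measurable_mem.
    apply/measurable_EFinP; apply: measurable_funB => //; exact: measurable_pairing.
  move=> _ [z _ <-]; apply: filterS (aF z) => w; rewrite /F -by_sum linearBl.
  case: ifP => _; last by move=> _; rewrite leey.
  case: (f z w) => [p| |//]; last by move=> _; rewrite leNye.
  rewrite -EFinB !lee_fin; lra.
apply: filterS => w + Bw; rewrite mem_set //.
case: (conjugate b mu f y w) => [c|//|_] /=; last by rewrite leey.
by rewrite -EFinB !lee_fin; lra.
Qed.

End minorant.

(** * Lower semi-continuity *)

Definition nbhs_inf (V : set (T -> X)) : T -> \bar R :=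
  essinf mu (step_ext f @` (V `&` Xs mu X)).

(** This is the conditional biconjugate of [f] at the constant [x]. *)
Definition dual_sup (x : X) : T -> \bar R :=
  esssup mu [set (fun w => (b x (y w))%:E - conjugate b mu f y w)%E | y in L0 mu Y].

Lemma measurable_nbhs_inf V : measurable_fun setT (nbhs_inf V).
Proof. by have [] := essinfP mu_sfin (step_ext f @` (V `&` Xs mu X)). Qed.

Lemma measurable_dual_sup x : measurable_fun setT (dual_sup x).
Proof.
by have [] := esssupP mu_sfin
  [set (fun w => (b x (y w))%:E - conjugate b mu f y w)%E | y in L0 mu Y].
Qed.

(* A constant [z] that satisfies the constraints of the neighbourhood only on
   [D] is tested by the step function equal to [z] on [D] and to [x] off [D]. *)
Lemma nbhs_inf_cond_ball_le x (r : T -> R) (N : T -> nat) (v : nat -> T -> Y) z n :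
  measurable_fun setT r -> {ae mu, forall w, 0 < r w} -> measurable_fun setT N ->
  (forall l, (1 <= l)%N -> L0 mu Y (v l)) ->
  {ae mu, forall w, N w = n ->
    seminorm_dist n (fun i => v i.+1) z x w <= r w ->
    (nbhs_inf (cond_ball b mu x r N v) w <= f z w)%E}.
Proof.
move=> mr r0 mN Lv.
pose D := [set w | N w = n] `&`
  [set w | seminorm_dist n (fun i => v i.+1) z x w <= r w].
have mNn : measurable [set w | N w = n].
  by rewrite -[X in measurable X]setTI; exact: (mN measurableT [set n]).
have mD : measurable D.
  apply: measurable_fun_le => //; last exact: measurable_funTS.
  by apply: measurable_funTS; apply: measurable_seminorm_dist => i; exact: Lv.
pose zt w := if w \in D then z else x.
have ztX : Xs mu X zt.
  exists (fun k => if k == 0%N then z else x), (bigcup2 D (~` D)); split.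
    split.
    - by move=> [|[|k]] //=; exact: measurableC.
    - by rewrite -trivIset_bigcup2 setICr.
    - by rewrite bigcup2E setUCr.
  move=> [|[|k]]; apply: aeW => w; rewrite /zt //= => Dw.
  - by rewrite mem_set.
  - by rewrite memNset.
have ztL : L0 mu X zt.
  exists (fun=> zt); split=> [_|]; last by apply: aeW => w; exact: cvg_cst.
  split=> [|u].
    apply: (sub_finite_set (B := [set z; x])) => // _ [w _ <-].
    by rewrite /zt; case: ifP; [left|right].
  have := measurable_mem mD measurableT
    (Y := [set c : bool | (if c then z else x) = u]).
  by rewrite setTI; apply.
have ztV : cond_ball b mu x r N v zt.
  split=> // l l1; apply: filterS r0 => w rw lN; rewrite /zt.
  case: ifPn => [|_]; last by rewrite subrr linear0l normr0 ltW.
  rewrite in_setE => -[/= Nw]; apply: le_trans.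
  (* Neighbourhoods number their dual elements from 1 and sums start at 0, hence the shift [v i.+1].
     A single term is at most the whole sum. *)
  case: l l1 lN => // l _; rewrite Nw => ln.
  rewrite /seminorm_dist (bigD1 (Ordinal ln)) //= lerDl.
  by apply: sumr_ge0 => i _.
have [_ lb _] := essinfP mu_sfin (step_ext f @` (cond_ball b mu x r N v `&` Xs mu X)).
apply: filterS (lb _ (imageP (step_ext f) (conj ztV ztX))) => w + Nw dw.
by rewrite /step_ext /zt mem_set.
Qed.

Lemma nbhs_inf_le x V : cond_nbhs b mu x V -> ae_le mu (nbhs_inf V) (f x).
Proof.
move=> [r [N [v [[mr r0] [mN _] Lv ->]]]].
have /ae_foralln := fun n => nbhs_inf_cond_ball_le x x n mr r0 mN Lv.
apply: filterS2 r0 => w rw /(_ (N w) erefl); apply.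
by rewrite seminorm_dist_refl ltW.
Qed.

(** Permits truncating an infimum that may be [+oo], since the minorant theorem takes a real-valued
    [m]. *)
Lemma lee_mine_nat (p q : \bar R) :
  (forall j : nat, mine p j%:R%:E <= q)%E -> (p <= q)%E.
Proof.
case: p => [p| |] h; last exact: leNye.
  have := h (Num.truncn p).+1; rewrite min_l // lee_fin ltW //.
  exact: truncnS_gt.
case: q h => [q| |] h //; last by have := h 0%N; rewrite min_r ?leey.
have := h (Num.truncn q).+1; rewrite min_r ?leey // lee_fin leNgt.
by rewrite truncnS_gt.
Qed.

(** The space is cut into countably many pieces on which [N] and [N'] are constant. Where the two
    infima allow real-valued bounds, after truncation at [j], the dual minorant yields a competitor
    for [dual_sup]. *)
Lemma nbhs_inf_le_dual_sup x x0 V V' :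
  {ae mu, forall w, f x0 w \is a fin_num} ->
  cond_nbhs b mu x V -> cond_nbhs b mu x0 V' ->
  {ae mu, forall w, (-oo < nbhs_inf V' w -> nbhs_inf V w <= dual_sup x w)%E}.
Proof.
move=> x0_dom nV nV'.
have I'le := nbhs_inf_le nV'.
have mI := measurable_nbhs_inf V; have mI' := measurable_nbhs_inf V'.
move: nV nV' => [r [N [v [[mr r0] [mN _] Lv VE]]]].
move=> [r' [N' [v' [[mr' r'0] [mN' _] Lv' VE']]]].
have /ae_forall_countType bound : forall i : nat * nat * nat, {ae mu, forall w,
    N w = i.1.1 -> N' w = i.1.2 ->
    (-oo < nbhs_inf V w -> -oo < nbhs_inf V' w < +oo ->
     mine (nbhs_inf V w) i.2%:R%:E <= dual_sup x w)%E}.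
  move=> [[n n'] j] /=.
  pose B := ([set w | N w = n] `&` [set w | N' w = n']) `&`
    ([set w | -oo < nbhs_inf V w]%E `&`
     ([set w | -oo < nbhs_inf V' w]%E `&` [set w | nbhs_inf V' w < +oo]%E)).
  pose m w := fine (mine (nbhs_inf V w) j%:R%:E).
  pose m' w := fine (nbhs_inf V' w).
  have mB : measurable B.
    apply: measurableI.
      by apply: measurableI; rewrite -[X in measurable X]setTI;
        [exact: (mN measurableT [set n])|exact: (mN' measurableT [set n'])].
    by apply: measurableI; [|apply: measurableI];
      rewrite -[X in measurable X]setTI; exact: measurable_lte.
  have mE w : B w -> (m w)%:E = mine (nbhs_inf V w) j%:R%:E.
    move=> [_ [/= Iw _]]; rewrite fineK // fin_numElt.
    by rewrite lt_min Iw ltNyr /= gt_min ltry orbT.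
  have m'E w : B w -> (m' w)%:E = nbhs_inf V' w.
    by move=> [_ [_ [/= Iw Iy]]]; rewrite fineK // fin_numElt Iw.
  have [||||||||||||y [Ly yP]] := @ex_dual_minorant
    (fun i => v i.+1) (fun i => v' i.+1) n n' _ _ r r' m m' _ _ _ _ _ _ B _ x x0.
  - by move=> i; exact: Lv.
  - by move=> i; exact: Lv'.
  - exact: mr.
  - exact: mr'.
  - by apply: measurableT_comp => //; exact: measurable_mine.
  - exact: measurableT_comp.
  - exact: r0.
  - exact: r'0.
  - exact: mB.
  - exact: x0_dom.
  - move=> z; apply: filterS (nbhs_inf_cond_ball_le x z n mr r0 mN Lv).
    move=> w + Bw; have [[Nw _] _] := Bw => /(_ Nw); rewrite -VE mE // => h dw.
    by apply: le_trans (h dw); rewrite ge_min lexx.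
  - move=> z; apply: filterS (nbhs_inf_cond_ball_le x0 z n' mr' r'0 mN' Lv').
    by move=> w + Bw; have [[_ N'w] _] := Bw => /(_ N'w); rewrite -VE' m'E.
  have [_ ub _] := esssupP mu_sfin
    [set (fun w => (b x (y w))%:E - conjugate b mu f y w)%E | y in L0 mu Y].
  apply: filterS2 yP (ub _ (imageP _ Ly)) => w yw uw Nw N'w Iw /andP[I'w I'y].
  have Bw : B w by [].
  by rewrite -mE //; apply: le_trans (yw Bw) uw.
(* The infimum over [V'] is below [+oo] because it is at most the finite value [f x0]. *)
apply: filterS3 bound I'le x0_dom => w bw I'w fx0 I'gt.
have [->|In] := eqVneq (nbhs_inf V w) -oo%E; first exact: leNye.
apply: lee_mine_nat => j; apply: (bw (N w, N' w, j)) => //.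
  by rewrite ltNye.
by rewrite I'gt (le_lt_trans I'w) // ltey_eq fx0.
Qed.

Lemma dual_sup_le x : ae_le mu (dual_sup x) (f x).
Proof.
have [_ _ lub] := esssupP mu_sfin
  [set (fun w => (b x (y w))%:E - conjugate b mu f y w)%E | y in L0 mu Y].
by apply: lub => // _ [y _ <-]; exact: fenchel_young.
Qed.

Lemma cond_lsc_dual_sup x : cond_lsc b mu f -> f x = dual_sup x %[ae mu].
Proof.
move=> lsc; have [f_gt [x0 x0_dom] _] := f_convex.
suff: ae_le mu (f x) (dual_sup x).
  move=> le1; apply: filterS2 le1 (dual_sup_le x) => w h1 h2 _.
  by apply/eqP; rewrite eq_le h1.
have [_ _ lubx] := esssupP mu_sfin [set nbhs_inf V | V in cond_nbhs b mu x].
have [_ _ lub0] := esssupP mu_sfin [set nbhs_inf V | V in cond_nbhs b mu x0].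
have : ae_le mu (esssup mu [set nbhs_inf V | V in cond_nbhs b mu x]) (dual_sup x).
  apply: lubx; first exact: measurable_dual_sup.
  move=> _ [V nV <-].
  (* Where the wanted inequality fails, every infimum over a neighbourhood of [x0] is a.e. [-oo], so
     [h] bounds them all. Their essential supremum is [f x0 > -oo] by semi-continuity, hence the
     failure set is null; no single [V'] has to work a.e. *)
  pose h w := if (nbhs_inf V w <= dual_sup x w)%E then +oo%E else -oo%E : \bar R.
  have : ae_le mu (esssup mu [set nbhs_inf V | V in cond_nbhs b mu x0]) h.
    apply: lub0.
      apply: measurable_fun_ifT => //; apply: measurable_fun_lee.
        exact: measurable_nbhs_inf.
      exact: measurable_dual_sup.
    move=> _ [V' nV' <-]; apply: filterS (nbhs_inf_le_dual_sup x0_dom nV nV') => w Vw.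
    rewrite /h; case: ifPn => [_|nle]; first exact: leey.
    by rewrite leNgt; apply: contra nle => /Vw.
  apply: filterS3 (lsc x0) (f_gt x0) => w fx0 fgt.
  rewrite -fx0 // /h; case: ifP => // _; rewrite leNgt fgt //.
by apply: filterS2 (lsc x) => w ->.
Qed.

(** Each competitor [<., y> - f*(y)] is a minorant of [f] that is continuous for the conditional
    neighbourhoods: the one given by [y] alone with radius [1/(k+1)] lets it drop by at most
    [1/(k+1)]. *)
Lemma dual_sup_cond_lsc : (forall x, f x = dual_sup x %[ae mu]) -> cond_lsc b mu f.
Proof.
move=> fE x.
have [mE ubE lubE] := esssupP mu_sfin [set nbhs_inf V | V in cond_nbhs b mu x].
set E := esssup mu [set nbhs_inf V | V in cond_nbhs b mu x] in mE ubE lubE.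
rewrite -/E.
have leE : ae_le mu E (f x).
  by apply: lubE => // _ [V nV <-]; exact: nbhs_inf_le.
have [_ _ lub] := esssupP mu_sfin
  [set (fun w => (b x (y w))%:E - conjugate b mu f y w)%E | y in L0 mu Y].
suff geE : ae_le mu (dual_sup x) E.
  apply: filterS3 leE geE (fE x) => w h1 h2 fw _.
  by apply/eqP; rewrite eq_le h1 andbT fw.
apply: lub => // _ [y Ly <-].
have /ae_foralln ek : forall k : nat, {ae mu, forall w,
    ((b x (y w))%:E - conjugate b mu f y w <= E w + k.+1%:R^-1%:E)%E}.
  move=> k; have k0 : 0 < k.+1%:R^-1 :> R by rewrite invr_gt0.
  pose V := cond_ball b mu x (cst k.+1%:R^-1) (cst 1%N) (fun=> y).
  have nV : cond_nbhs b mu x V.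
    exists (cst k.+1%:R^-1), (cst 1%N), (fun=> y); split=> //.
    by split=> //; exact: aeW.
  have [_ _ glb] := essinfP mu_sfin (step_ext f @` (V `&` Xs mu X)).
  have := ubE _ (imageP nbhs_inf nV).
  have : ae_le mu (fun w =>
      ((b x (y w))%:E - conjugate b mu f y w - k.+1%:R^-1%:E)%E) (nbhs_inf V).
    apply: glb.
      apply: emeasurable_funB => //; apply: emeasurable_funB.
        by apply/measurable_EFinP; exact: measurable_pairing.
      exact: measurable_conjugate.
    move=> _ [z [[_ zV] [xs [A [[mA _ AT] zA]]]] <-].
    have /ae_foralln zA' := zA.
    (* A step function has countably many values, so the null sets of the Fenchel-Young inequality
       at these values can be united. *)
    have /ae_foralln fy := fun n => fenchel_young (xs n) y.
    apply: filterS3 zA' fy (zV 1%N isT) => w zw fw zw1.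
    have [n _ An] : (\bigcup_n A n) w by rewrite AT.
    rewrite /step_ext (zw n An); apply: le_trans (fw n) => /=.
    move: zw1 => /(_ isT) /=; rewrite linearBl (zw n An) ler_norml => /andP[zw1 _].
    case: (conjugate b mu f y w) => [c|//|//].
    by rewrite -!EFinB lee_fin addrAC lerD2r addrC -lerBrDr.
  apply: filterS2 => w h1 h2.
  by rewrite -leeBlDr // (le_trans h1).
apply: filterS ek => w ew; apply/lee_addgt0Pr => e e0.
have [k] := ltr_add_invr e0; rewrite add0r => ke.
by apply: le_trans (ew k) _; rewrite leeD2l // lee_fin ltW.
Qed.

End pairing.

Theorem theorem4p2 (R : realType) (d : measure_display) (T : measurableType d)
  (mu : {sigma_finite_measure set T -> \bar R})
  (mu_complete : measure_is_complete mu) (mu_gt0 : (0 < mu setT)%E)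
  (X Y : completeNormedModType R)
  (b : {bilinear X -> Y -> R | *%R & *%R})
  (b_sep : separating b)
  (b_norm : forall (x : X) (y : Y), `|b x y| <= `|x| * `|y|)
  (ballX_closed : weakly_closed b [set x : X | `|x| <= 1])
  (ballY_closed : weakly_closed (fun y x => b x y) [set y : Y | `|y| <= 1])
  (f : X -> T -> \bar R) (f_meas : forall x, measurable_fun setT (f x))
  (f_convex : proper_convex mu f) :
  cond_lsc b mu f <->
  (forall x : X,
    f x = esssup mu [set (fun w => (b x (y w))%:E - conjugate b mu f y w)%E
                      | y in L0 mu Y] %[ae mu]).
Proof.
have mu_sfin : sigma_finite setT mu by exact: sigma_finiteT.
split=> [lsc x|fE].
- exact: (cond_lsc_dual_sup mu_complete mu_sfin b_norm f_meas f_convex x lsc).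
- exact: (dual_sup_cond_lsc mu_complete mu_sfin b_norm f_meas fE).
Qed.
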